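(* Let $(X,d)$ be a (nonempty) complete metric space and $f:X\to\mathcal{I}$ an interval-valued function. Suppose that (i) $f$ is $\preccurlyeq$-lower semicontinuous and $\preccurlyeq$-lower bounded; (ii) for any $x\in X$ with $x\notin\mathrm{Min}(f,X)$, there is $y\in X$, $y\ne x$, such that $f(y)+[d(x,y),d(x,y)]\preccurlyeq f(x)$. Then $\mathrm{Min}(f,X)\ne\emptyset$.
   Context: $\mathcal{I}=\{[a,b]:a\le b,\ a,b\in\mathbb{R}\}$ is the set of closed bounded real intervals, with addition $[\underline{a},\overline{a}]+[\underline{b},\overline{b}]=[\underline{a}+\underline{b},\overline{a}+\overline{b}]$. $[\underline{a},\overline{a}]\preccurlyeq[\underline{b},\overline{b}]$ means $\underline{a}\le\underline{b}$ and $\overline{a}\le\overline{b}$; $[\underline{a},\overline{a}]\prec[\underline{b},\overline{b}]$ means $\underline{a}<\underline{b}$ and $\overline{a}<\overline{b}$. $\mathrm{Min}(f,X)$ is the set of all $x_0\in X$ for which there is no $x\in X$ with $f(x)\prec f(x_0)$. $f:X\to\mathcal{I}$ is $\preccurlyeq$-lower semicontinuous if for every $A\in\mathcal{I}$ the set $\{x\in X:f(x)\preccurlyeq A\}$ is closed, and $\preccurlyeq$-lower bounded if there is $A\in\mathcal{I}$ with $A\preccurlyeq f(x)$ for all $x\in X$. *)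

(* Defs.v *)
From HB Require Import structures.
From mathcomp Require Import all_boot all_order all_algebra.
From mathcomp Require Import all_classical all_reals all_analysis.

Set Implicit Arguments.
Unset Strict Implicit.
Unset Printing Implicit Defensive.

Import Order.TTheory GRing.Theory Num.Theory.

Local Open Scope classical_set_scope.
Local Open Scope ring_scope.

(* A complete metric space.  [Complete] includes a distinguished point, so these
   spaces are nonempty. *)
#[short(type="completeMetricType")]
HB.structure Definition CompleteMetric (R : numDomainType) :=
  { M of Metric R M & Complete M }.

(* The interval [lo, hi] is represented by its endpoints.  MathComp's
   [interval R] is not used because it also contains open, unbounded and empty
   intervals. *)
Record citv (R : realType) := CItv {
  lo : R;
  hi : R;
  lo_le_hi : lo <= hi
}.

Section IntervalValued.
Variable R : realType.
Implicit Types A B : citv R.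

Definition citv_add A B : citv R :=
  CItv (lerD (lo_le_hi A) (lo_le_hi B)).

Definition citv_pt (r : R) : citv R := CItv (lexx r).

Definition citv_le A B : Prop := lo A <= lo B /\ hi A <= hi B.

(* Both endpoints are strictly smaller: this is not the strict part of
   [citv_le]. *)
Definition citv_lt A B : Prop := lo A < lo B /\ hi A < hi B.

Definition Min (X : Type) (f : X -> citv R) : set X :=
  [set x0 | ~ exists x, citv_lt (f x) (f x0)].

Definition citv_lsc (X : topologicalType) (f : X -> citv R) : Prop :=
  forall A, closed [set x | citv_le (f x) A].

Definition citv_lbounded (X : Type) (f : X -> citv R) : Prop :=
  exists A, forall x, citv_le A (f x).

End IntervalValued.

(* Main.v *)
Require Import Defs.
From mathcomp Require Import all_boot all_order all_algebra.
From mathcomp Require Import all_classical all_reals all_analysis.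
From mathcomp Require Import lra.

(** Read hypothesis (ii) through the relation [caristi_le f x y], which holds
    when [f y + d(x,y)] is below [f x].  By the triangle inequality it is a
    preorder, and a step along it pays for the distance travelled by a decrease
    of the lower endpoint, [d(x,y) <= lo (f x) - lo (f y)], a quantity that is
    bounded below.  This is the order of the Ekeland and Caristi theorems.
    Hypothesis (ii) says that a point outside [Min f] can be improved strictly
    for this preorder, so any point admitting no strict improvement lies in
    [Min f].

    Such a point is found by the Ekeland argument
    ([closed_preorder_endpoint]): descend so that the n-th step gets within
    [1/(n+1)] of the infimum of [lo \o f] over the points still reachable.  The
    reachable sets then shrink to diameter 0, and because they are closed and
    the space is complete they meet in exactly one point, which can reach
    nothing but itself.

    Lower semicontinuity enters only through closedness of the reachable sets
    ([closed_caristi_le]).  It concerns both endpoints jointly, and [lo \o f]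
    need not be lower semicontinuous by itself; it suffices because near [y]
    the reachable points lie in one sublevel set of [f], at the interval [f x]
    shifted down by [d(x,y) - e]. *)

Import Order.TTheory GRing.Theory Num.Theory.

Local Open Scope classical_set_scope.
Local Open Scope ring_scope.

(** The greedy choice: [y] nearly minimizes [phi] over all of [A], so that no
    later point of [A] can have a value much smaller than [phi y]. *)
Lemma near_minimizer (R : realType) (T : Type) (phi : T -> R) (m : R)
    (A : set T) (e : R) :
  (forall x, m <= phi x) -> A !=set0 -> 0 < e ->
  exists2 y, A y & forall z, A z -> phi y - phi z <= e.
Proof.
move=> mphi [a Aa] e_gt0.
have lbA : has_lbound (phi @` A) by exists m => _ [x _ <-].
have infA : has_inf (phi @` A) by split=> //; exists (phi a), a.
have [_ [y Ay <-] phiy] := inf_adherent e_gt0 infA.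
exists y => // z Az; have : inf (phi @` A) <= phi z by apply: ge_inf => //; exists z.
lra.
Qed.

(** An abstract form of Ekeland's principle.  Nothing is assumed on the
    continuity of [phi]: it only bounds distances, and topology enters through
    the closedness of the sets [S x]. *)
Lemma closed_preorder_endpoint (R : realType) (X : completeMetricType R)
    (S : X -> set X) (phi : X -> R) (m : R) :
  (forall x, S x x) ->
  (forall x y z, S x y -> S y z -> S x z) ->
  (forall x, closed (S x)) ->
  (forall x y, S x y -> mdist x y <= phi x - phi y) ->
  (forall x, m <= phi x) ->
  exists x, forall y, S x y -> y = x.
Proof.
move=> Sxx Strans Sclosed Sdist mphi.
have /choice[g gP] (p : nat * X) : exists y, S p.2 y /\
    forall z, S p.2 z -> phi y - phi z <= p.1.+1%:R^-1.
  have [||y Sy ymin] := @near_minimizer _ _ _ _ (S p.2) p.1.+1%:R^-1 mphi.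
  - by exists p.2.
  - by rewrite invr_gt0 ltr0n.
  - by exists y.
pose u : nat -> X := fix u n := if n is k.+1 then g (k, u k) else point.
have uS n : S (u n) (u n.+1) by have [] := gP (n, u n).
have Su n k : S (u n) (u (n + k)%N).
  elim: k => [|k IHk]; first by rewrite addn0.
  by rewrite addnS; exact: Strans IHk (uS _).
have Sdiam n z : S (u n.+1) z -> mdist (u n.+1) z <= n.+1%:R^-1.
  move=> Sz; apply: le_trans (Sdist _ _ Sz) _.
  by have [_] := gP (n, u n); apply; exact: Strans (uS n) Sz.
have u_cvg : cvg (u @ \oo).
  apply: cauchy_cvg; apply: cauchy_exP => e e_gt0.
  have [N _ Ne] := near_infty_natSinv_lt (PosNum e_gt0).
  exists (u N.+1); exists N.+1 => // n /= /subnKC <-.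
  rewrite ballEmdist /=; apply: le_lt_trans (Sdiam _ _ (Su _ _)) _.
  exact: Ne (leqnn N).
(* A point that stays reachable forever is the limit of the sequence. *)
have S_lim z : (forall n, S (u n) z) -> u @ \oo --> z.
  move=> Sz; apply/metricType_numDomainType.cvgrPdist_lt => e e_gt0.
  have [N _ Ne] := near_infty_natSinv_lt (PosNum e_gt0).
  exists N.+1 => // -[//|n] /= Nn.
  rewrite metric_sym; apply: le_lt_trans (Sdiam _ _ (Sz _)) _.
  exact: Ne Nn.
exists (lim (u @ \oo)) => z Sz.
have Slim n : S (u n) (lim (u @ \oo)).
  apply: (closed_cvg (S (u n)) (Sclosed _) _ _ u_cvg).
  by exists n => // k /= /subnKC <-.
apply: (cvg_unique (@metric_hausdorff _ X) _ u_cvg).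
by apply: S_lim => n; exact: Strans (Slim n) Sz.
Qed.

Definition caristi_le {R : realType} {X : completeMetricType R}
    (f : X -> citv R) (x : X) : set X :=
  [set y | citv_le (citv_add (f y) (citv_pt (mdist x y))) (f x)].

Lemma caristi_le_refl (R : realType) (X : completeMetricType R)
    (f : X -> citv R) (x : X) : caristi_le f x x.
Proof. by rewrite /caristi_le /citv_le /= mdistxx !addr0. Qed.

Lemma caristi_le_trans (R : realType) (X : completeMetricType R)
    (f : X -> citv R) (x y z : X) :
  caristi_le f x y -> caristi_le f y z -> caristi_le f x z.
Proof.
rewrite /caristi_le /citv_le /= => -[? ?] [? ?].
have := metric_triangle x y z; lra.
Qed.

(** A reachable [z] within [e] of [y] satisfies [d(x,z) > d(x,y) - e], hence
    [f z] is below [f x] shifted by [e - d(x,y)].  This bound is the same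
    interval for all such [z], so it passes to [y] in their closure, and then
    [e] tends to 0. *)
Lemma closed_caristi_le (R : realType) (X : completeMetricType R)
    (f : X -> citv R) (x : X) : citv_lsc f -> closed (caristi_le f x).
Proof.
move=> f_lsc y cl_y.
have near_le e : 0 < e ->
    citv_le (f y) (citv_add (f x) (citv_pt (e - mdist x y))).
  move=> e_gt0; apply: f_lsc => B yB.
  have [z [[lo_z hi_z] [Bz]]] := cl_y _ (filterI yB (nbhsx_ballx y e e_gt0)).
  rewrite ballEmdist /= => yz; exists z; split=> //.
  move: lo_z hi_z; have := metric_triangle x z y; rewrite (metric_sym z y).
  by rewrite /citv_le /=; lra.
split; apply/ler_addgt0Pr => e /near_le[]; rewrite /=; lra.
Qed.

Theorem theorem4p3 (R : realType) (X : completeMetricType R)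
    (f : X -> citv R)
    (f_lsc : citv_lsc f)
    (f_lbounded : citv_lbounded f)
    (f_descent : forall x : X, ~ Min f x ->
       exists y : X, y <> x /\
         citv_le (citv_add (f y) (citv_pt (mdist x y))) (f x)) :
  Min f !=set0.
Proof.
have [A fA] := f_lbounded.
have [x x_end] : exists x, forall y, caristi_le f x y -> y = x.
  apply: (@closed_preorder_endpoint R X _ (fun x => lo (f x)) (lo A)).
  - exact: caristi_le_refl.
  - exact: caristi_le_trans.
  - by move=> x; exact: closed_caristi_le.
  - by move=> x y [] /=; lra.
  - by move=> x; have [] := fA x.
exists x; apply: contrapT => /f_descent[y [y_neq_x le_yx]].
exact/y_neq_x/x_end.
Qed.
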